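(* Let $(\mathcal L,[\cdot_\lambda\cdot],\alpha)$ be a multiplicative Hom-Lie conformal algebra, $(\rho,\mathcal M,\beta)$ a representation of it, and $\mathcal T:\mathcal M\to\mathcal L$ an $\mathcal O$-operator with respect to $(\rho,\mathcal M,\beta)$. Let $\delta_{\mathcal T}=\{\!\{\mathcal T,-\}\!\}$, and let $\delta_{\beta,\alpha}$ be the coboundary operator of the sub-adjacent Hom-Lie conformal algebra $\mathcal M^c_\beta$ with coefficients in the representation $(\rho_{\mathcal T},\mathcal L,\alpha)$, both acting on $C^*_{\beta,\alpha}(\mathcal M,\mathcal L)$. Then for every $p\ge1$ and every $P\in C^p_{\beta,\alpha}(\mathcal M,\mathcal L)$, $$\delta_{\beta,\alpha}(P)=(-1)^p\{\!\{\mathcal T,P\}\!\}=(-1)^p\delta_{\mathcal T}(P).$$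
   Context: All vector spaces and tensor products are over $\mathbb C$; $\lambda,\mu,\lambda_i$ are formal variables. Expressions such as $[y_{-\lambda-\partial}x]$ mean: expand $[y_\mu x]=\sum_k\mu^kc_k$ and take $\sum_k(-\lambda-\partial)^kc_k$. A Hom-Lie conformal algebra $(\mathcal L,[\cdot_\lambda\cdot],\alpha)$ is a $\mathbb C[\partial]$-module with a $\mathbb C$-bilinear map $\mathcal L\otimes\mathcal L\to\mathcal L[\lambda]$ and a $\mathbb C$-linear $\alpha$ with $\alpha\partial=\partial\alpha$, such that $[\partial x_\lambda y]=-\lambda[x_\lambda y]$, $[x_\lambda\partial y]=(\partial+\lambda)[x_\lambda y]$, $[x_\lambda y]=-[y_{-\lambda-\partial}x]$, $[\alpha(x)_\lambda[y_\mu z]]=[[x_\lambda y]_{\lambda+\mu}\alpha(z)]+[\alpha(y)_\mu[x_\lambda z]]$; it is multiplicative if $\alpha([x_\lambda y])=[\alpha(x)_\lambda\alpha(y)]$. $gc(V)$ is the space of $\mathbb C$-linear maps $\varphi_\lambda:V\to V[\lambda]$ with $\varphi_\lambda(\partial v)=(\partial+\lambda)\varphi_\lambda(v)$, with $(\partial\varphi)_\lambda=-\lambda\varphi_\lambda$. A representation is a triple $(\rho,\mathcal M,\beta)$ with $\mathcal M$ a $\mathbb C[\partial]$-module, $\beta:\mathcal M\to\mathcal M$ $\mathbb C$-linear with $\beta\partial=\partial\beta$, $\rho:\mathcal L\to gc(\mathcal M)$ $\mathbb C[\partial]$-linear, such that $\beta(\rho(x)_\lambda m)=\rho(\alpha(x))_\lambda\beta(m)$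 and $\rho([x_\lambda y])_{\lambda+\mu}\beta(m)=\rho(\alpha(x))_\lambda\rho(y)_\mu m-\rho(\alpha(y))_\mu\rho(x)_\lambda m$. A $\mathbb C[\partial]$-module homomorphism $\mathcal T:\mathcal M\to\mathcal L$ is an $\mathcal O$-operator if $\mathcal T\beta=\alpha\mathcal T$ and $[\mathcal T(m)_\lambda\mathcal T(n)]=\mathcal T(\rho(\mathcal T(m))_\lambda n-\rho(\mathcal T(n))_{-\partial-\lambda}m)$. Then $\mathcal M^c_\beta=(\mathcal M,[\cdot_\lambda\cdot]^c,\beta)$ with $[m_\lambda n]^c=\rho(\mathcal Tm)_\lambda n-\rho(\mathcal Tn)_{-\partial-\lambda}m$ is a Hom-Lie conformal algebra (the sub-adjacent one), with representation $(\rho_{\mathcal T},\mathcal L,\alpha)$, $\rho_{\mathcal T}(m)_\lambda(x)=[\mathcal T(m)_\lambda x]+\mathcal T(\rho(x)_{-\partial-\lambda}m)$. Cochains. For $\mathbb C[\partial]$-modules $V,W$ with $\mathbb C$-linear endomorphisms $\gamma,\gamma'$ commuting with $\partial$, let $C^p_{\gamma,\gamma'}(V,W)$ ($p\ge1$) be the space of $\mathbb C$-linear maps $f_{\lambda_1,\dots,\lambda_{p-1}}:V^{\otimes p}\to W[\lambda_1,\dots,\lambda_{p-1}]$ such that (i) $\gamma'(f(v_1,\dots,v_p))=f(\gamma(v_1),\dots,\gamma(v_p))$; (ii) replacing $v_i$ by $\partial v_i$ multiplies the value by $-\lambda_i$ if $i\le p-1$ and by $\partial+\lambda_1+\cdots+\lambda_{p-1}$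 if $i=p$; (iii) for every permutation $\tau$, $f_{\lambda_1,\dots,\lambda_{p-1}}(v_1,\dots,v_p)=\operatorname{sgn}(\tau)f_{\lambda_{\tau(1)},\dots,\lambda_{\tau(p-1)}}(v_{\tau(1)},\dots,v_{\tau(p)})|_{\lambda_p=-\lambda_1-\cdots-\lambda_{p-1}-\partial}$. This defines $C^p_{\beta,\alpha}(\mathcal M,\mathcal L)$, and with $E=\mathcal L\oplus\mathcal M$, $\gamma=\alpha+\beta$, put $C^n_\gamma(E,E):=C^n_{\gamma,\gamma}(E,E)$. Convention: in a formula with $N$ arguments and free variables $\lambda_1,\dots,\lambda_{N-1}$, $\lambda_N$ stands for $-\lambda_1-\cdots-\lambda_{N-1}-\partial$, with $\partial$ acting from the left on the total value; and the parameter attached to the last argument of a cochain is always omitted from its list of subscripts. The coboundary operator is, for $f\in C^p_{\beta,\alpha}(\mathcal M,\mathcal L)$, $$(\delta_{\beta,\alpha}f)_{\lambda_1,\dots,\lambda_p}(m_1,\dots,m_{p+1})=\sum_{i=1}^{p+1}(-1)^{i+1}\rho_{\mathcal T}(\beta^{p-1}(m_i))_{\lambda_i}f_{\lambda_1,\dots,\widehat{\lambda_i},\dots}(m_1,\dots,\widehat{m_i},\dots,m_{p+1})+\sum_{i<j}(-1)^{i+j}f_{\lambda_i+\lambda_j,\lambda_1,\dots,\widehat{\lambda_i},\dots,\widehat{\lambda_j},\dots}([{m_i}_{\lambda_i}m_j]^c,\beta(m_1),\dots,\widehat{m_i},\dots,\widehat{m_j},\dots,\beta(m_{p+1})).$$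 For $f\in C^m_\gamma(E,E)$, $g\in C^n_\gamma(E,E)$, $$(f\circledcirc g)_{\lambda_1,\dots,\lambda_{m+n-2}}(e_1,\dots,e_{m+n-1})=\sum_{\tau\in S_{n,m-1}}\operatorname{sgn}(\tau)f_{\lambda_{\tau(1)}+\cdots+\lambda_{\tau(n)},\lambda_{\tau(n+1)},\dots,\lambda_{\tau(m+n-2)}}\big(g_{\lambda_{\tau(1)},\dots,\lambda_{\tau(n-1)}}(e_{\tau(1)},\dots,e_{\tau(n)}),\gamma^{n-1}(e_{\tau(n+1)}),\dots,\gamma^{n-1}(e_{\tau(m+n-1)})\big),$$ with $S_{n,m-1}$ the permutations with $\tau(1)<\cdots<\tau(n)$, $\tau(n+1)<\cdots<\tau(n+m-1)$, and $[f,g]^{\alpha+\beta}_{NR}=f\circledcirc g-(-1)^{(m-1)(n-1)}g\circledcirc f$. Let $(m_c+\rho)_\lambda((x,a),(y,b))=([x_\lambda y],\rho(x)_\lambda b-\rho(y)_{-\partial-\lambda}a)$, an element of $C^2_\gamma(E,E)$. Identify $f\in C^p_{\beta,\alpha}(\mathcal M,\mathcal L)$ with $((x_1,a_1),\dots,(x_p,a_p))\mapsto(f(a_1,\dots,a_p),0)$ in $C^p_\gamma(E,E)$. For $f\in C^q_{\beta,\alpha}(\mathcal M,\mathcal L)$, $g\in C^p_{\beta,\alpha}(\mathcal M,\mathcal L)$, $$\{\!\{f,g\}\!\}=(-1)^q[[m_c+\rho,f]^{\alpha+\beta}_{NR},g]^{\alpha+\beta}_{NR}\in C^{p+q}_{\beta,\alpha}(\mathcal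 M,\mathcal L).$$ *)

(* Defs.v *)
From HB Require Import structures.
From mathcomp Require Import all_boot all_order all_algebra all_fingroup.
From mathcomp Require Import finmap.
From mathcomp Require Import monalg.

Set Implicit Arguments.
Unset Strict Implicit.
Unset Printing Implicit Defensive.

Import GRing.Theory.
Local Open Scope ring_scope.

(* A K[d]-module is an lmodType over {poly K}; the operator d is 'X *: _ and
   a scalar c : K acts as c%:P *: _.  Polynomials in formal variables with
   coefficients in a module W are finitely supported families of elements of
   W indexed by monomials. *)

Section MalgLift.
Context (X : choiceType) (G H : zmodType).

Lemma malg_ind (P : {malg G[X]} -> Prop) :
  P 0 -> (forall F1 F2, P F1 -> P F2 -> P (F1 + F2)) ->
  (forall k w, P << w *g k >>) -> forall F, P F.
Proof. by move=> P0 PD PU F; rewrite (monalgE F); elim/big_ind: _. Qed.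

Definition mlift (h : X -> G -> H) (F : {malg G[X]}) : H :=
  \sum_(k <- msupp F) h k F@_k.

Lemma mliftEw (h : X -> {additive G -> H}) (F : {malg G[X]}) (d : {fset X}) :
  (msupp F `<=` d)%fset -> mlift h F = \sum_(k <- d) h k F@_k.
Proof.
move=> le; rewrite /mlift (big_fset_incl _ le) // => x _ /mcoeff_outdom ->.
exact: raddf0.
Qed.

Lemma mliftD (h : X -> {additive G -> H}) : {morph mlift h : F1 F2 / F1 + F2}.
Proof.
move=> F1 F2; set d := (msupp F1 `|` msupp F2)%fset.
rewrite !(@mliftEw _ _ d) ?fsubsetUl ?fsubsetUr ?msuppD_le //.
by rewrite -big_split; apply: eq_bigr => k _; rewrite mcoeffD raddfD.
Qed.

Lemma mliftU (h : X -> {additive G -> H}) (k : X) (w : G) :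
  mlift h << w *g k >> = h k w.
Proof. by rewrite (mliftEw _ msuppU_le) big_seq_fset1 mcoeffUU. Qed.

End MalgLift.

(* pring K N is K[d][l_1, ..., l_N]; lpoly N W is W[l_1, ..., l_N], a module
   over pring K N: the l_i act by shifting monomials and d on coefficients. *)
Notation pring K N := {malg {poly K}['X_{1..N}]}.

Definition lpoly (K : fieldType) (N : nat) (W : lmodType {poly K}) : Type :=
  {malg W['X_{1..N}]}.

HB.instance Definition _ (K : fieldType) (N : nat) (W : lmodType {poly K}) :=
  GRing.Zmodule.on (@lpoly K N W).

Definition lpoly_mono (K : fieldType) (N : nat) (W : lmodType {poly K})
  (a k : 'X_{1..N}) (c : {poly K}) (w : W) : @lpoly K N W :=
  << c *: w *g mmul a k >>.

HB.lock Definition lpoly_scale (K : fieldType) (N : nat)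
  (W : lmodType {poly K}) (p : pring K N) (F : lpoly N W) : lpoly N W :=
  mlift (fun a c => mlift (fun k w => lpoly_mono a k c w) F) p.
Canonical lpoly_scale_unlockable := Unlockable lpoly_scale.unlock.

Section LpolyModule.
Context (K : fieldType) (N : nat) (W : lmodType {poly K}).
Implicit Types (a k : 'X_{1..N}) (c : {poly K}) (w : W).
Implicit Types (p q : pring K N) (F : @lpoly K N W).
Local Notation lpoly_scale := (@lpoly_scale K N W).

Lemma lpoly_mono_additive a k c : additive (@lpoly_mono K N W a k c).
Proof. by move=> u v; rewrite /lpoly_mono scalerBr raddfB. Qed.

HB.instance Definition _ a k c :=
  GRing.isAdditive.Build W (lpoly N W) (@lpoly_mono K N W a k c)
    (lpoly_mono_additive a k c).

Definition lpoly_row F (a : 'X_{1..N}) (c : {poly K}) : lpoly N W :=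
  mlift (fun k w => lpoly_mono a k c w) F.

Lemma lpoly_row_additive F a : additive (lpoly_row F a).
Proof.
move=> c e; rewrite /lpoly_row /mlift -sumrB; apply: eq_bigr => k _.
by rewrite /lpoly_mono scalerBl raddfB.
Qed.

HB.instance Definition _ F a :=
  GRing.isAdditive.Build {poly K} (lpoly N W) (lpoly_row F a)
    (lpoly_row_additive F a).

Lemma lpoly_scaleDl F : {morph lpoly_scale^~ F : p q / p + q}.
Proof. by move=> p q; rewrite unlock; apply: (mliftD (fun a => lpoly_row F a)). Qed.

Lemma lpoly_scaleDr : right_distributive lpoly_scale +%R.
Proof.
move=> p F1 F2; rewrite unlock /mlift -big_split; apply: eq_bigr => a _.
exact: (mliftD (fun k => lpoly_mono a k p@_a)).
Qed.

Lemma lpoly_scale_mono a c k w :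
  lpoly_scale << c *g a >> << w *g k >> = lpoly_mono a k c w.
Proof.
rewrite unlock (mliftU (fun a => lpoly_row _ a)).
exact: (mliftU (fun k => @lpoly_mono K N W a k c)).
Qed.

Lemma lpoly_scale0l F : lpoly_scale 0 F = 0.
Proof. by rewrite unlock /mlift msupp0 big_seq_fset0. Qed.

Lemma lpoly_scale0r p : lpoly_scale p 0 = 0.
Proof. by apply: (@addrI _ (lpoly_scale p 0)); rewrite -lpoly_scaleDr !addr0. Qed.

Lemma lpoly_scaleA p q F :
  lpoly_scale p (lpoly_scale q F) = lpoly_scale (p * q) F.
Proof.
elim/malg_ind: F => [|F1 F2 h1 h2|k w].
- by rewrite (lpoly_scale0r q) (lpoly_scale0r p) (lpoly_scale0r (p * q)).
- rewrite (lpoly_scaleDr q F1 F2) (lpoly_scaleDr (p * q) F1 F2).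
  by rewrite (lpoly_scaleDr p (lpoly_scale q F1)) h1 h2.
elim/malg_ind: p => [|p1 p2 h1 h2|a c].
- by rewrite mul0r (lpoly_scale0l << w *g k >>) lpoly_scale0l.
- by rewrite mulrDl (lpoly_scaleDl _ p1 p2) (lpoly_scaleDl _ (p1 * q)) h1 h2.
elim/malg_ind: q => [|q1 q2 h1 h2|b e].
- by rewrite mulr0 (lpoly_scale0l << w *g k >>) lpoly_scale0r.
- rewrite mulrDr (lpoly_scaleDl _ q1 q2) (lpoly_scaleDl _ (_ * q1)).
  by rewrite (lpoly_scaleDr _ (lpoly_scale q1 _)) h1 h2.
have -> : << c *g a >> * << e *g b >> = << c * e *g mmul a b >> :> pring K N.
  exact: fgmulUU.
have E1 := lpoly_scale_mono b e k w.
have E2 : lpoly_scale << c *g a >> (lpoly_mono b k e w) =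
    lpoly_mono a (mmul b k) c (e *: w) by exact: lpoly_scale_mono.
have E3 := lpoly_scale_mono (mmul a b) (c * e) k w.
apply: (etrans (congr1 _ E1)); apply: (etrans E2); apply: (etrans _ (esym E3)).
rewrite /lpoly_mono (scalerA c e w) (mulmA a b k); congr mkmalgU.
Qed.

Lemma lpoly_scale1 : left_id 1 lpoly_scale.
Proof.
move=> F; elim/malg_ind: F => [|F1 F2 h1 h2|k w].
- exact: lpoly_scale0r.
- by rewrite lpoly_scaleDr h1 h2.
by rewrite lpoly_scale_mono /lpoly_mono scale1r mul1m.
Qed.

HB.instance Definition _ :=
  GRing.Zmodule_isLmodule.Build (pring K N) (lpoly N W)
    lpoly_scaleA lpoly_scale1 lpoly_scaleDr lpoly_scaleDl.

End LpolyModule.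

Section Substitution.
Context (K : fieldType).
Implicit Types (N n : nat) (V W : lmodType {poly K}).

Definition lvar N (i : 'I_N) : pring K N := << 1 *g ucm i >>.
Definition dvar N : pring K N := << 'X *g mone >>.
Definition cvar N (c : K) : pring K N := << c%:P *g mone >>.
Definition lconst N W (w : W) : lpoly N W := << w *g mone >>.

(* The parameters attached to N + 1 arguments: the first N of them are free
   variables and the last one stands for - l_1 - ... - l_N - d. *)
Definition lam N (i : 'I_N.+1) : pring K N :=
  if unlift ord_max i is Some j then lvar j else - \sum_(j < N) lvar j - dvar N.

(* For F = \sum_m l^m w_m this is \sum_m theta^m *: h w_m.  As the powers of
   the theta_i multiply h w_m from outside, an operator d occurring in some
   theta_i acts from the left on the total value. *)
Definition lpoly_ext n N V W (theta : 'I_n -> pring K N)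
    (h : V -> lpoly N W) (F : lpoly n V) : lpoly N W :=
  mlift (fun (m : 'X_{1..n}) w => (\prod_(i < n) theta i ^+ m i) *: h w) F.

Definition lpoly_subst n N W (theta : 'I_n -> pring K N) (F : lpoly n W) :
  lpoly N W := lpoly_ext theta (@lconst N W) F.

(* F_q for F in W[l] *)
Definition at1 N W (q : pring K N) (F : lpoly 1 W) : lpoly N W :=
  lpoly_subst (fun=> q) F.

Definition lpoly_map N V W (g : V -> W) (F : lpoly N V) : lpoly N W :=
  mlift (fun m w => << g w *g m >>) F.

(* (F, G) in (V (+) W)[l_1, ..., l_N] = V[l_1, ..., l_N] (+) W[l_1, ..., l_N] *)
Definition lpoly_pair N V W (F : lpoly N V) (G : lpoly N W) :
    lpoly N (V * W)%type :=
  lpoly_map (fun v => (v, 0)) F + lpoly_map (fun w => (0, w)) G.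

Definition scons T (x : T) (h : nat -> T) (k : nat) : T :=
  if k is k'.+1 then h k' else x.

End Substitution.

Section HomLieConformal.
Context (K : fieldType).
Implicit Types (L M V W : lmodType {poly K}).

Definition C_linear V W (g : V -> W) : Prop :=
  forall (c : K) x y, g (c%:P *: x + y) = c%:P *: g x + g y.

Definition C_linear_poly N V W (g : V -> lpoly N W) : Prop :=
  forall (c : K) x y, g (c%:P *: x + y) = cvar N c *: g x + g y.

Definition d_commuting V (g : V -> V) : Prop :=
  forall x, g ('X *: x) = 'X *: g x.

Local Notation l := (lvar K (ord0 : 'I_1)).
Local Notation d := (dvar K _).
Local Notation la := (lvar K (ord0 : 'I_2)).
Local Notation mu := (lvar K (ord_max : 'I_2)).

Record hom_lie_conformal L (br : L -> L -> lpoly 1 L) (alpha : L -> L) :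
    Prop := HomLieConformal {
  hlc_linear_l : forall y, C_linear_poly (br^~ y);
  hlc_linear_r : forall x, C_linear_poly (br x);
  hlc_alpha_linear : C_linear alpha;
  hlc_alpha_d : d_commuting alpha;
  hlc_d_l : forall x y, br ('X *: x) y = - l *: br x y;
  hlc_d_r : forall x y, br x ('X *: y) = (d + l) *: br x y;
  hlc_skew : forall x y, br x y = - at1 (- l - d) (br y x);
  hlc_jacobi : forall x y z,
    lpoly_ext (fun=> mu) (fun w => at1 la (br (alpha x) w)) (br y z) =
    lpoly_ext (fun=> la) (fun w => at1 (la + mu) (br w (alpha z))) (br x y) +
    lpoly_ext (fun=> la) (fun w => at1 mu (br (alpha y) w)) (br x z)
}.

Definition hlc_multiplicative L (br : L -> L -> lpoly 1 L) (alpha : L -> L) :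
    Prop :=
  forall x y, lpoly_map alpha (br x y) = br (alpha x) (alpha y).

Record in_gc V (phi : V -> lpoly 1 V) : Prop := InGc {
  gc_linear : C_linear_poly phi;
  gc_d : forall v, phi ('X *: v) = (d + l) *: phi v
}.

Record hlc_representation L (br : L -> L -> lpoly 1 L) (alpha : L -> L)
    M (rho : L -> M -> lpoly 1 M) (beta : M -> M) : Prop := HlcRepresentation {
  rep_beta_linear : C_linear beta;
  rep_beta_d : d_commuting beta;
  rep_gc : forall x, in_gc (rho x);
  rep_linear : forall m, C_linear_poly (rho^~ m);
  rep_d : forall x m, rho ('X *: x) m = - l *: rho x m;
  rep_equivariant : forall x m,
    lpoly_map beta (rho x m) = rho (alpha x) (beta m);
  rep_bracket : forall x y m,
    lpoly_ext (fun=> la) (fun w => at1 (la + mu) (rho w (beta m))) (br x y) =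
    lpoly_ext (fun=> mu) (fun n => at1 la (rho (alpha x) n)) (rho y m) -
    lpoly_ext (fun=> la) (fun n => at1 mu (rho (alpha y) n)) (rho x m)
}.

(* [m_l n]^c *)
Definition subadj_bracket L M (rho : L -> M -> lpoly 1 M) (T : M -> L)
    (m n : M) : lpoly 1 M :=
  rho (T m) n - at1 (- d - l) (rho (T n) m).

Definition O_operator L (br : L -> L -> lpoly 1 L) (alpha : L -> L)
    M (rho : L -> M -> lpoly 1 M) (beta : M -> M) (T : {linear M -> L}) :
    Prop :=
  (forall m, T (beta m) = alpha (T m)) /\
  (forall m n, br (T m) (T n) =
    lpoly_map T (rho (T m) n - at1 (- d - l) (rho (T n) m))).

(* rho_T *)
Definition subadj_action L (br : L -> L -> lpoly 1 L)
    M (rho : L -> M -> lpoly 1 M) (T : M -> L) (m : M) (x : L) : lpoly 1 L :=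
  br (T m) x + lpoly_map T (at1 (- d - l) (rho x m)).

End HomLieConformal.

Section Cochains.
Context (K : fieldType).
Implicit Types (L M V W : lmodType {poly K}).

Definition cmap p V W : Type := {ffun 'I_p -> V} -> lpoly p.-1 W.

Definition update p V (v : {ffun 'I_p -> V}) (i : 'I_p) (x : V) :
  {ffun 'I_p -> V} := [ffun k => if k == i then x else v k].

(* Membership in C^(p+1)(V, W); the factor - lam i in cochain_d is - l_i when
   i is not the last index and d + l_1 + ... + l_p when it is. *)
Record cochain V (gamma : V -> V) W (gamma' : W -> W) p (f : cmap p.+1 V W) :
    Prop := Cochain {
  cochain_linear : forall v i, C_linear_poly (fun x => f (update v i x));
  cochain_equivariant : forall v,
    lpoly_map gamma' (f v) = f [ffun i => gamma (v i)];
  cochain_d : forall v i, f (update v i ('X *: v i)) = - lam K i *: f v;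
  cochain_skew : forall (v : {ffun 'I_p.+1 -> V}) (tau : 'S_p.+1),
    f v = (-1) ^+ tau *:
      lpoly_subst (fun k : 'I_p => lam K (tau (widen_ord (leqnSn p) k)))
        (f [ffun i => v (tau i)])
}.

(* The coboundary operator for a bracket br and a twist beta on V and an
   action r of V on W.  Indices start at 0, which does not change the parity
   of i + j; t |-> bump j (bump i t) enumerates the indices other than i < j in
   increasing order. *)
Definition coboundary V (br : V -> V -> lpoly 1 V) (beta : V -> V)
    W (r : V -> W -> lpoly 1 W) p (f : cmap p.+1 V W) : cmap p.+2 V W :=
  fun m =>
    \sum_(i < p.+2) (-1) ^+ i *:
      lpoly_ext (fun k : 'I_p => lam K (lift i (widen_ord (leqnSn p) k)))
        (fun w => at1 (lam K i) (r (iter p beta (m i)) w))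
        (f [ffun k : 'I_p.+1 => m (lift i k)])
  + \sum_(i < p.+2) \sum_(j < p.+2 | (i < j)%N) (-1) ^+ (i + j)%N *:
      lpoly_ext (fun=> lam K i)
        (fun u =>
           let rest t : 'I_p.+2 := inord (bump j (bump i t)) in
           lpoly_subst
             (fun k : 'I_p =>
                scons (lam K i + lam K j) (fun t => lam K (rest t)) k)
             (f [ffun k : 'I_p.+1 => scons u (fun t => beta (m (rest t))) k]))
        (br (m i) (m j)).

Definition shuffle N n (tau : 'S_N) : bool :=
  [forall i : 'I_N, forall j : 'I_N,
    (i < j)%N && ((i < n)%N == (j < n)%N) ==> (tau i < tau j)%N].

(* f (o) g for f in C^(m+1) and g in C^(n+1).  The arity N + 1 of the result
   is only relevant for N = m + n; it is a parameter so that f (o) g and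
   g (o) f have the same type in NR_bracket.  Under this condition no inord
   below is out of range. *)
Definition circ V (gamma : V -> V) N m n
    (f : cmap m.+1 V V) (g : cmap n.+1 V V) : cmap N.+1 V V :=
  fun e =>
    \sum_(tau : 'S_N.+1 | shuffle n.+1 tau) (-1) ^+ tau *:
      let head i : 'I_N.+1 := tau (inord i) in
      let tail t : 'I_N.+1 := tau (inord (n.+1 + t)%N) in
      lpoly_ext (fun k : 'I_n => lam K (head k))
        (fun u =>
           lpoly_subst
             (fun k : 'I_m =>
                scons (\sum_(i < n.+1) lam K (head i))
                  (fun t => lam K (tail t)) k)
             (f [ffun k : 'I_m.+1 =>
                   scons u (fun t => iter n gamma (e (tail t))) k]))
        (g [ffun k : 'I_n.+1 => e (head k)]).

Definition NR_bracket V (gamma : V -> V) m n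
    (f : cmap m.+1 V V) (g : cmap n.+1 V V) : cmap (m + n)%N.+1 V V :=
  fun e => circ gamma f g e - (-1) ^+ (m * n)%N *: circ gamma g f e.

Definition twist_sum L M (alpha : L -> L) (beta : M -> M) (e : L * M) :
  (L * M)%type := (alpha e.1, beta e.2).

(* m_c + rho *)
Definition semidirect L M (br : L -> L -> lpoly 1 L)
    (rho : L -> M -> lpoly 1 M) : cmap 2 (L * M)%type (L * M)%type :=
  fun e =>
    let x := (e ord0).1 in let a := (e ord0).2 in
    let y := (e ord_max).1 in let b := (e ord_max).2 in
    lpoly_pair (br x y)
      (rho x b - at1 (- dvar K 1 - lvar K ord0) (rho y a)).

Definition embed L M p (f : cmap p M L) : cmap p (L * M)%type (L * M)%type :=
  fun e => lpoly_pair (f [ffun i => (e i).2]) 0.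

Definition cochain1 L M (T : M -> L) : cmap 1 M L :=
  fun m => lconst 0 (T (m ord0)).

(* {{f, g}}, as an element of C(E, E) with E = L (+) M *)
Definition derived_bracket L (br : L -> L -> lpoly 1 L) (alpha : L -> L)
    M (rho : L -> M -> lpoly 1 M) (beta : M -> M)
    q p (f : cmap q.+1 M L) (g : cmap p.+1 M L) :
    cmap (q + p)%N.+2 (L * M)%type (L * M)%type :=
  let gamma := twist_sum alpha beta in
  fun e => (-1) ^+ q.+1 *:
    NR_bracket gamma
      (NR_bracket gamma (m := 1) (semidirect br rho) (embed f)) (embed g) e.

Definition delta_T L (br : L -> L -> lpoly 1 L) (alpha : L -> L)
    M (rho : L -> M -> lpoly 1 M) (beta : M -> M) (T : M -> L)
    p (P : cmap p.+1 M L) : cmap p.+2 (L * M)%type (L * M)%type :=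
  derived_bracket br alpha rho beta (cochain1 T) P.

Definition delta_beta_alpha L (br : L -> L -> lpoly 1 L)
    M (rho : L -> M -> lpoly 1 M) (beta : M -> M) (T : M -> L)
    p (P : cmap p.+1 M L) : cmap p.+2 M L :=
  coboundary (subadj_bracket rho T) beta (subadj_action br rho T) P.

End Cochains.

(* Main.v *)
(** The operation [circ] sums over shuffles.  For a 2-cochain composed with a
    (p+1)-cochain the shuffles are indexed by the element sent to the last
    place, and for the opposite composition by the pair sent to the first two
    places, so each half of [[m_c + rho, T], P] already has the shape of one
    half of the coboundary formula.

    The bracket nu = [m_c + rho, T] has the sub-adjacent bracket as its
    M-component, and restricted to arguments (w, 0), (y, b) it is
    - (rho_T(b) w, 0) with the parameter of the second argument.  Hence nu o P
    gives the terms with rho_T and P o nu those with the sub-adjacent bracket.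
    The signs follow from those of the two families of shuffles. *)

Require Import Defs.
From HB Require Import structures.
From mathcomp Require Import all_boot all_order all_algebra all_fingroup.
From mathcomp Require Import finmap monalg.
From mathcomp Require Import reals complex.

Set Implicit Arguments.
Unset Strict Implicit.
Unset Printing Implicit Defensive.

Import GRing.Theory.
Local Open Scope ring_scope.

(** * Polynomials with coefficients in a module *)

Section ZmodMorphism.
Context (U V : zmodType) (f : U -> V) (fB : zmod_morphism f).

Lemma zmod_morphism0 : f 0 = 0.
Proof. by rewrite -(subrr 0) fB subrr. Qed.

Lemma zmod_morphismN : {morph f : x / - x}.
Proof. by move=> x; rewrite -sub0r fB zmod_morphism0 sub0r. Qed.

Lemma zmod_morphismD : {morph f : x y / x + y}.
Proof. by move=> x y; rewrite -{1}[y]opprK fB zmod_morphismN opprK. Qed.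

Lemma zmod_morphism_sum I (r : seq I) (P : pred I) (F : I -> U) :
  f (\sum_(i <- r | P i) F i) = \sum_(i <- r | P i) f (F i).
Proof. exact: (big_morph f zmod_morphismD zmod_morphism0). Qed.

End ZmodMorphism.

(** The three signs are that of the claimed identity, that of the derived bracket with [T] in first
    place, and that of the outer NR bracket. Multiplied out, nu o P keeps [(-1) ^+ p] and P o nu
    keeps a single minus sign. *)
Lemma scale_sign_sub (R : pzRingType) (V : lmodType R) p (x y : V) :
  (-1) ^+ p.+1 *: ((-1) ^+ 1 *: (x - (-1) ^+ p *: y)) = (-1) ^+ p *: x - y.
Proof.
rewrite expr1 scaleN1r exprS mulN1r scaleNr scalerN opprK scalerBr.
by rewrite scalerA -expr2 sqrr_sign scale1r.
Qed.

Section MalgMorphism.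
Context (X : choiceType) (G H : zmodType).

(** Additivity is handled as a plain proposition, since most maps below are anonymous functions
    without a declared additive structure; the structure is packed only inside the proof, to reach
    [mliftD]. *)
Lemma mlift_zmod_morphism (h : X -> G -> H) :
  (forall k, zmod_morphism (h k)) -> zmod_morphism (mlift h).
Proof.
move=> hB F1 F2.
pose hh k : {additive G -> H} :=
  HB.pack (h k) (GRing.isZmodMorphism.Build G H (h k) (hB k)).
have hhB : zmod_morphism (mlift hh).
  move=> x y; apply: (@addIr _ (mlift hh y)).
  by rewrite -(mliftD hh) !subrK.
exact: hhB.
Qed.

Lemma mlift_monomial (h : X -> G -> H) k w :
  (forall k, zmod_morphism (h k)) -> mlift h << w *g k >> = h k w.
Proof.
move=> hB.
pose hh k : {additive G -> H} :=
  HB.pack (h k) (GRing.isZmodMorphism.Build G H (h k) (hB k)).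
exact: (mliftU hh).
Qed.

(** Monomials generate the finitely supported families additively. Most identities about
    substitutions and coefficient maps below are reduced to monomials in this way. *)
Lemma eq_zmod_morphism_malg (f g : {malg G[X]} -> H) :
  zmod_morphism f -> zmod_morphism g ->
  (forall k w, f << w *g k >> = g << w *g k >>) -> f =1 g.
Proof.
move=> fB gB fg F; elim/malg_ind: F => [|F1 F2 h1 h2|//].
- by rewrite !zmod_morphism0.
by rewrite !zmod_morphismD // h1 h2.
Qed.

End MalgMorphism.

(* Locked because comparing two such monomials by conversion unfolds the finite
   maps that represent them and does not terminate in practice. *)
HB.lock Definition lmonomial (K : fieldType) (N : nat) (W : lmodType {poly K})
  (m : 'X_{1..N}) (w : W) : lpoly N W := << w *g m >>.

(** * Substitution of parameters *)

Section LpolyTheory.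
Context (K : fieldType).
Implicit Types (n N : nat) (V W : lmodType {poly K}).

Lemma comp_zmod_morphism (A B C : zmodType) (f : B -> C) (g : A -> B) :
  zmod_morphism f -> zmod_morphism g -> zmod_morphism (fun x => f (g x)).
Proof. by move=> fB gB x y; rewrite gB fB. Qed.

Lemma scale_zmod_morphism (A : zmodType) (R : pzRingType) (B : lmodType R)
  (f : A -> B) (c : R) :
  zmod_morphism f -> zmod_morphism (fun x => c *: f x).
Proof. by move=> fB x y; rewrite fB scalerBr. Qed.

Lemma lmonomial_zmod_morphism N W (m : 'X_{1..N}) :
  zmod_morphism (@lmonomial K N W m).
Proof. rewrite unlock; exact: monalgUB. Qed.

Lemma eq_zmod_morphism_lpoly n V (A : zmodType) (f g : lpoly n V -> A) :
  zmod_morphism f -> zmod_morphism g ->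
  (forall m w, f (lmonomial m w) = g (lmonomial m w)) -> f =1 g.
Proof. rewrite unlock; exact: eq_zmod_morphism_malg. Qed.

Lemma lconstE N W (w : W) : lconst N w = lmonomial mone w.
Proof. by rewrite unlock. Qed.

Lemma scale_lmonomial N W (c : {poly K}) (a m : 'X_{1..N}) (w : W) :
  (<< c *g a >> : pring K N) *: lmonomial m w = lmonomial (mmul a m) (c *: w).
Proof. rewrite unlock; exact: lpoly_scale_mono. Qed.

Lemma lvar_lmonomial N W i (m : 'X_{1..N}) (w : W) :
  lvar K i *: lmonomial m w = lmonomial (mmul (ucm i) m) w.
Proof. by apply: etrans (scale_lmonomial _ _ _ _) _; rewrite scale1r. Qed.

Lemma dvar_lmonomial N W (m : 'X_{1..N}) (w : W) :
  dvar K N *: lmonomial m w = lmonomial m ('X *: w).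
Proof. by apply: etrans (scale_lmonomial _ _ _ _) _; rewrite mul1m. Qed.

Lemma eq_lpoly_ext n N V W (theta theta' : 'I_n -> pring K N)
    (h h' : V -> lpoly N W) F F' :
  theta =1 theta' -> h =1 h' -> F = F' ->
  lpoly_ext theta h F = lpoly_ext theta' h' F'.
Proof.
move=> et eh <-; rewrite /lpoly_ext /mlift; apply: eq_bigr => k _.
rewrite (eh F@_k); apply: (congr1 (fun c => c *: _)).
by apply: eq_bigr => i _; rewrite et.
Qed.

Lemma eq_lpoly_subst n N W (theta theta' : 'I_n -> pring K N)
    (F F' : lpoly n W) :
  theta =1 theta' -> F = F' -> lpoly_subst theta F = lpoly_subst theta' F'.
Proof. by move=> et eF; apply: eq_lpoly_ext. Qed.

Lemma lpoly_extN n N V W (theta : 'I_n -> pring K N) (h : V -> lpoly N W) F :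
  lpoly_ext theta (fun v => - h v) F = - lpoly_ext theta h F.
Proof.
rewrite /lpoly_ext /mlift -sumrN; apply: eq_bigr => k _.
by rewrite scalerN.
Qed.

Section Ext.
Context (n N : nat) (V W : lmodType {poly K}) (theta : 'I_n -> pring K N).
Context (h : V -> lpoly N W) (hB : zmod_morphism h).

Lemma lpoly_ext_zmod_morphism : zmod_morphism (lpoly_ext theta h).
Proof. by apply: mlift_zmod_morphism => m; apply: scale_zmod_morphism. Qed.

Lemma lpoly_ext_lmonomial m w :
  lpoly_ext theta h (lmonomial m w) = (\prod_(i < n) theta i ^+ m i) *: h w.
Proof.
by rewrite unlock; apply: mlift_monomial => k; apply: scale_zmod_morphism.
Qed.

Lemma lpoly_ext_const w : lpoly_ext theta h (lconst n w) = h w.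
Proof.
rewrite lconstE lpoly_ext_lmonomial big1 ?scale1r // => i _.
by rewrite cm1 expr0.
Qed.

(** Multiplication by l_i raises the i-th exponent of every monomial by one, which after
    substitution costs one more factor [theta i]. *)
Lemma lpoly_ext_scale_lvar i F :
  lpoly_ext theta h (lvar K i *: F) = theta i *: lpoly_ext theta h F.
Proof.
move: F; apply: eq_zmod_morphism_lpoly.
- apply: comp_zmod_morphism; first exact: lpoly_ext_zmod_morphism.
  by move=> x y; rewrite scalerBr.
- exact/scale_zmod_morphism/lpoly_ext_zmod_morphism.
move=> m w; rewrite lvar_lmonomial !lpoly_ext_lmonomial scalerA.
congr (_ *: _); under eq_bigr => j _ do rewrite cmM exprD.
rewrite big_split /=; congr (_ * _).
rewrite (bigD1 i) //= cmUU expr1 big1 ?mulr1 // => j ji.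
by rewrite cmU eq_sym (negbTE ji) expr0.
Qed.

End Ext.

Lemma lconst_zmod_morphism N W : zmod_morphism (@lconst K N W).
Proof. by move=> x y; rewrite !lconstE lmonomial_zmod_morphism. Qed.

Lemma subst_zmod_morphism n N W (theta : 'I_n -> pring K N) :
  zmod_morphism (@lpoly_subst K n N W theta).
Proof. exact/lpoly_ext_zmod_morphism/lconst_zmod_morphism. Qed.

Lemma at1_zmod_morphism N W (q : pring K N) : zmod_morphism (@at1 K N W q).
Proof. exact: subst_zmod_morphism. Qed.

Lemma subst_const n N W (theta : 'I_n -> pring K N) (w : W) :
  lpoly_subst theta (lconst n w) = lconst N w.
Proof. exact/lpoly_ext_const/lconst_zmod_morphism. Qed.

Lemma subst_scale_lvar n N W (theta : 'I_n -> pring K N) i (F : lpoly n W) :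
  lpoly_subst theta (lvar K i *: F) = theta i *: lpoly_subst theta F.
Proof. exact/lpoly_ext_scale_lvar/lconst_zmod_morphism. Qed.

(** Before substitution d acts on coefficients, afterwards it multiplies from outside. The two agree
    because [pring] is commutative, even when [theta] itself contains d. *)
Lemma subst_scale_dvar n N W (theta : 'I_n -> pring K N) (F : lpoly n W) :
  lpoly_subst theta (dvar K n *: F) = dvar K N *: lpoly_subst theta F.
Proof.
move: F; apply: eq_zmod_morphism_lpoly.
- apply: comp_zmod_morphism; first exact: subst_zmod_morphism.
  by move=> x y; rewrite scalerBr.
- exact/scale_zmod_morphism/subst_zmod_morphism.
move=> m w; have cB := @lconst_zmod_morphism N W.
rewrite dvar_lmonomial /lpoly_subst !lpoly_ext_lmonomial //.
have -> : lconst N ('X *: w) = dvar K N *: lconst N w.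
  by rewrite !lconstE dvar_lmonomial.
by rewrite !scalerA mulrC.
Qed.

Lemma at1_scale_NdBl N W (q : pring K N) (F : lpoly 1 W) :
  at1 q ((- dvar K 1 - lvar K ord0) *: F) = (- dvar K N - q) *: at1 q F.
Proof.
have aB := at1_zmod_morphism q.
rewrite scalerBl scaleNr aB (zmod_morphismN (aB W)) scalerBl scaleNr.
apply: (congr2 (fun x y => - x - y)).
- exact: subst_scale_dvar.
- exact: subst_scale_lvar.
Qed.

Lemma at1_lmonomial N W (q : pring K N) m (w : W) :
  at1 q (lmonomial m w) = q ^+ m ord0 *: lconst N w.
Proof.
apply: etrans (lpoly_ext_lmonomial _ (@lconst_zmod_morphism N W) m w) _.
by rewrite big_ord1.
Qed.

(** Substitution fixes d, so putting q for l in - d - l gives - d - q. Applied to - d - q instead of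
    q, the two reversals cancel. *)
Lemma at1_at1 N W (q : pring K N) (F : lpoly 1 W) :
  at1 q (at1 (- dvar K 1 - lvar K ord0) F) = at1 (- dvar K N - q) F.
Proof.
move: F; apply: eq_zmod_morphism_lpoly.
- by apply: comp_zmod_morphism; exact: at1_zmod_morphism.
- exact: at1_zmod_morphism.
move=> m w; rewrite !at1_lmonomial.
elim: (m ord0) => [|k IHk].
  by rewrite !expr0 !scale1r; exact: subst_const.
rewrite exprS -scalerA at1_scale_NdBl IHk scalerA -exprS.
by [].
Qed.

Lemma lvarX1 k : (lvar K ord0 : pring K 1) ^+ k =
  << 1 *g iter k (mmul (ucm ord0)) mone >>.
Proof.
elim: k => [|k IHk]; first by [].
rewrite exprS IHk; apply: etrans (fgmulUU _ _ _ _) _.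
exact: (congr1 (fun c => << c *g _ >>) (mulr1 1)).
Qed.

Lemma at1_id W (F : lpoly 1 W) : at1 (lvar K ord0) F = F.
Proof.
move: F; apply: eq_zmod_morphism_lpoly.
- exact: at1_zmod_morphism.
- by move=> x y.
move=> m w; rewrite at1_lmonomial lvarX1 lconstE.
apply: etrans (scale_lmonomial _ _ _ _) _.
rewrite scale1r mulm1.
congr lmonomial; apply/eqP/cmP => i; rewrite !ord1.
by elim: (m ord0) => [|k IHk]; rewrite ?cm1 //= cmM cmUU IHk.
Qed.

End LpolyTheory.

(** * Maps on coefficients and direct sums *)

Section LpolyMap.
Context (K : fieldType).
Implicit Types (n N : nat) (V W : lmodType {poly K}).

Section Map.
Context (V W : lmodType {poly K}) (g : V -> W) (gB : zmod_morphism g).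

Lemma lpoly_map_zmod_morphism N : zmod_morphism (@lpoly_map K N V W g).
Proof.
by apply: mlift_zmod_morphism => m x y; rewrite gB; exact: monalgUB.
Qed.

Lemma lpoly_map_lmonomial N (m : 'X_{1..N}) w :
  lpoly_map g (lmonomial m w) = lmonomial m (g w).
Proof.
rewrite unlock; apply: (mlift_monomial (h := fun m w => << g w *g m >>)).
by move=> k x y; rewrite gB; exact: monalgUB.
Qed.

Lemma lpoly_map_const N w : lpoly_map g (lconst N w) = lconst N (g w).
Proof. by rewrite !lconstE lpoly_map_lmonomial. Qed.

Lemma lpoly_ext_map n N (U : lmodType {poly K}) (theta : 'I_n -> pring K N)
    (h : W -> lpoly N U) F :
  zmod_morphism h ->
  lpoly_ext theta h (lpoly_map g F) = lpoly_ext theta (fun v => h (g v)) F.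
Proof.
move=> hB; have hgB : zmod_morphism (fun v => h (g v)).
  exact: comp_zmod_morphism.
move: F; apply: eq_zmod_morphism_lpoly.
- apply: comp_zmod_morphism (@lpoly_map_zmod_morphism n).
  exact: lpoly_ext_zmod_morphism.
- exact: lpoly_ext_zmod_morphism.
by move=> m w; rewrite lpoly_map_lmonomial !lpoly_ext_lmonomial.
Qed.

Context (gZ : scalable g).

(** K[d]-linearity of [g] makes it commute with d as well as with the formal variables. This is what
    moves [T] through substitutions that involve d. *)
Lemma lpoly_map_scale N (c : pring K N) (F : lpoly N V) :
  lpoly_map g (c *: F) = c *: lpoly_map g F.
Proof.
have mB := @lpoly_map_zmod_morphism N.
move: F; apply: eq_zmod_morphism_lpoly.
- by apply: comp_zmod_morphism mB _ => x y; exact: scalerBr.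
- exact: scale_zmod_morphism.
move=> m w; rewrite lpoly_map_lmonomial.
move: c; apply: eq_zmod_morphism_malg.
- by apply: comp_zmod_morphism mB _ => x y; exact: scalerBl.
- by move=> x y; exact: scalerBl.
move=> a c; apply: etrans (congr1 _ (scale_lmonomial _ _ _ _)) _.
apply: etrans (lpoly_map_lmonomial _ _) _.
by rewrite gZ; apply/esym/scale_lmonomial.
Qed.

Lemma lpoly_map_ext n N (U : lmodType {poly K}) (theta : 'I_n -> pring K N)
    (h : U -> lpoly N V) F :
  zmod_morphism h ->
  lpoly_map g (lpoly_ext theta h F) =
  lpoly_ext theta (fun v => lpoly_map g (h v)) F.
Proof.
move=> hB; have mB := @lpoly_map_zmod_morphism N.
have mhB := comp_zmod_morphism mB hB.
have eB := lpoly_ext_zmod_morphism theta hB.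
move: F; apply: eq_zmod_morphism_lpoly.
- exact: comp_zmod_morphism.
- exact: lpoly_ext_zmod_morphism.
by move=> m w; rewrite !lpoly_ext_lmonomial // lpoly_map_scale.
Qed.

Lemma lpoly_map_subst n N (theta : 'I_n -> pring K N) F :
  lpoly_map g (lpoly_subst theta F) = lpoly_subst theta (lpoly_map g F).
Proof.
rewrite /lpoly_subst lpoly_map_ext; last exact: lconst_zmod_morphism.
rewrite lpoly_ext_map; last exact: lconst_zmod_morphism.
by apply: eq_lpoly_ext => // w; apply: lpoly_map_const.
Qed.

End Map.

Section Pair.
Context (V W : lmodType {poly K}).

Lemma inl_zmod_morphism : zmod_morphism (fun v : V => (v, 0) : (V * W)%type).
Proof. by move=> x y; congr (_, _); rewrite /= subr0. Qed.

Lemma inr_zmod_morphism : zmod_morphism (fun w : W => (0, w) : (V * W)%type).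
Proof. by move=> x y; congr (_, _); rewrite /= subr0. Qed.

Lemma inl_scalable : scalable (fun v : V => (v, 0) : (V * W)%type).
Proof. by move=> c x; congr (_, _); rewrite /= scaler0. Qed.

Lemma inr_scalable : scalable (fun w : W => (0, w) : (V * W)%type).
Proof. by move=> c x; congr (_, _); rewrite /= scaler0. Qed.

Hint Resolve inl_zmod_morphism inr_zmod_morphism inl_scalable inr_scalable
  : core.

Lemma lpoly_pairl N (F : lpoly N V) :
  lpoly_pair F 0 = lpoly_map (fun v : V => (v, 0) : (V * W)%type) F.
Proof.
have mB := lpoly_map_zmod_morphism inr_zmod_morphism (N := N).
rewrite /lpoly_pair (zmod_morphism0 mB).
exact: addr0.
Qed.

Lemma lpoly_pairB N (F F' : lpoly N V) (G G' : lpoly N W) :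
  lpoly_pair (F - F') (G - G') = lpoly_pair F G - lpoly_pair F' G'.
Proof.
by rewrite /lpoly_pair !lpoly_map_zmod_morphism // opprD addrACA.
Qed.

Lemma lpoly_pairl_zmod_morphism N :
  zmod_morphism (fun F : lpoly N V => lpoly_pair F (0 : lpoly N W)).
Proof. by move=> F G; rewrite -lpoly_pairB subr0. Qed.

Lemma lpoly_pairlZ N c (F : lpoly N V) :
  lpoly_pair (c *: F) (0 : lpoly N W) = c *: lpoly_pair F 0.
Proof. by rewrite !lpoly_pairl lpoly_map_scale. Qed.

Lemma lpoly_ext_pair n N (U : lmodType {poly K}) (theta : 'I_n -> pring K N)
    (h : (V * W)%type -> lpoly N U) (F : lpoly n V) (G : lpoly n W) :
  zmod_morphism h ->
  lpoly_ext theta h (lpoly_pair F G) =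
  lpoly_ext theta (fun v => h (v, 0)) F + lpoly_ext theta (fun w => h (0, w)) G.
Proof.
move=> hB; rewrite /lpoly_pair.
rewrite (zmod_morphismD (lpoly_ext_zmod_morphism _ hB)).
by apply: (congr2 +%R); exact: lpoly_ext_map.
Qed.

Lemma subst_pair n N (theta : 'I_n -> pring K N) (F : lpoly n V)
    (G : lpoly n W) :
  lpoly_subst theta (lpoly_pair F G) =
  lpoly_pair (lpoly_subst theta F) (lpoly_subst theta G).
Proof.
rewrite /lpoly_pair (zmod_morphismD (subst_zmod_morphism theta)).
by apply: (congr2 +%R); exact/esym/lpoly_map_subst.
Qed.

Lemma lpoly_ext_pairl n N (U : lmodType {poly K}) (theta : 'I_n -> pring K N)
    (h : U -> lpoly N V) (F : lpoly n U) :
  zmod_morphism h ->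
  lpoly_ext theta (fun u => lpoly_pair (h u) (0 : lpoly N W)) F =
  lpoly_pair (lpoly_ext theta h F) 0.
Proof.
move=> hB; rewrite lpoly_pairl lpoly_map_ext //.
by apply: eq_lpoly_ext => // u; exact: lpoly_pairl.
Qed.

End Pair.

End LpolyMap.

(** * Parameters attached to the arguments *)

Section Lam.
Context (K : fieldType).

Lemma lam_widen N (k : 'I_N) : lam K (widen_ord (leqnSn N) k) = lvar K k.
Proof.
rewrite (_ : widen_ord _ k = lift ord_max k) /lam ?liftK //.
exact/val_inj/esym/lift_max.
Qed.

Lemma lam_max N : lam K (@ord_max N) = - \sum_(j < N) lvar K j - dvar K N.
Proof. by rewrite /lam unlift_none. Qed.

Lemma sum_lam N : \sum_(i < N.+1) lam K i = - dvar K N.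
Proof.
rewrite big_ord_recr /= lam_max.
apply: (etrans (congr1 (fun x => x + _) (eq_bigr _ (fun k _ => lam_widen k)))).
by rewrite addrA subrr sub0r.
Qed.

(** When all arguments but the i-th sit inside an inner cochain, this is the parameter that the
    outer one receives; a further reversal by [at1_at1] turns it into l_i. *)
Lemma sum_lam_lift N (i : 'I_N.+1) :
  \sum_(k < N) lam K (lift i k) = - dvar K N - lam K i.
Proof.
apply: (@addrI _ (lam K i)); rewrite -sum_lam (bigD1_ord i) //=.
by rewrite [RHS]addrCA subrr addr0.
Qed.

End Lam.

(** * Shuffles *)

Section Shuffles.

Lemma shuffleP N n (s : 'S_N) :
  reflect (forall i j : 'I_N, (i < j)%N -> (i < n)%N = (j < n)%N ->
             (s i < s j)%N) (shuffle n s).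
Proof.
apply: (iffP forallP) => [sh i j ij e | sh i].
  by have /forallP/(_ j)/implyP := sh i; apply; rewrite ij e eqxx.
by apply/forallP => j; apply/implyP => /andP[ij /eqP]; apply: sh.
Qed.

(** Once the values on one block are fixed, those on the other form the complementary set, and the
    shuffle condition forces its increasing enumeration. *)
Lemma shuffle_eq N n (s t : 'S_N) (b : bool) :
  shuffle n s -> shuffle n t ->
  (forall i : 'I_N, (i < n)%N != b -> s i = t i) -> s = t.
Proof.
move=> shs sht st.
(* [A] lists the block on which agreement has to be proved; its images under [s] and [t] are sorted
   lists with the same members, hence equal. *)
pose A := [seq i : 'I_N <- enum 'I_N | (i < n)%N == b].
have ltn_tr : transitive (fun i j : 'I_N => (i < j)%N).
  by move=> x y z; apply: ltn_trans.
have sortA (u : 'S_N) :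
    shuffle n u -> sorted (fun i j : 'I_N => (i < j)%N) (map u A).
  move=> /shuffleP shu; apply: (homo_sorted_in (P := mem A)
      (e := fun i j : 'I_N => (i < j)%N)).
  - move=> i j; rewrite !mem_filter => /andP[/eqP ib _] /andP[/eqP jb _] ij.
    by apply: shu; rewrite ?ib ?jb.
  - exact/allP.
  apply: sorted_filter => //.
  have := iota_ltn_sorted 0 N; rewrite -val_enum_ord sorted_map.
  exact.
have memA (u : 'S_N) x : (x \in map u A) = (((u^-1)%g x < n)%N == b).
  by rewrite -{1}(permKV u x) (mem_map perm_inj) mem_filter mem_enum andbT.
have stA : map s A = map t A.
  apply: (irr_sorted_eq ltn_tr); [by move=> x; apply: ltnn|exact: sortA..|].
  move=> x; rewrite !memA; apply/idP/idP; apply: contraLR => xb.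
    by rewrite -{1}(permKV t x) -st // permK.
  by rewrite -{1}(permKV s x) st // permK.
apply/permP => i; have [ib|/st//] := eqVneq (i < n)%N b.
by move/eq_in_map: stA; apply; rewrite mem_filter ib eqxx mem_enum.
Qed.

Lemma ltn_lift N (h : 'I_N) (i j : 'I_N.-1) :
  (lift h i < lift h j)%N = (i < j)%N.
Proof. by rewrite !ltnNge /= leq_bump2. Qed.

Lemma lift_perm_max_shuffle N (i : 'I_N.+1) :
  shuffle N (lift_perm ord_max i 1%g).
Proof.
apply/shuffleP => a b; case: (unliftP ord_max a) => [a'|] ->.
  case: (unliftP ord_max b) => [b'|] ->.
    by rewrite !lift_perm_lift !perm1 !ltn_lift.
  by rewrite lift_max ltn_ord ltnn.
by rewrite ltnNge -ltnS ltn_ord.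
Qed.

Lemma big_shuffle_max (V : nmodType) N (F : 'S_N.+1 -> V) :
  \sum_(s : 'S_N.+1 | shuffle N s) F s =
  \sum_(i < N.+1) F (lift_perm ord_max i 1%g).
Proof.
rewrite (reindex_onto (fun i => lift_perm ord_max i 1%g)
           (fun s : 'S_N.+1 => s ord_max)) => [|s shs].
  by apply: eq_bigl => i; rewrite lift_perm_max_shuffle lift_perm_id eqxx.
apply: (shuffle_eq (b := true) (lift_perm_max_shuffle _) shs) => i.
rewrite eqb_id -leqNgt => iN; suff -> : i = ord_max by rewrite lift_perm_id.
by apply/val_inj/anti_leq; rewrite iN -ltnS ltn_ord.
Qed.

(** For i < j this is the shuffle with first block sent to i, j. Once i is removed, j has position j
    - 1, which explains [inord j.-1]. *)
Definition lift_pair_perm N (i j : 'I_N.+2) : 'S_N.+2 :=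
  lift_perm ord0 i (lift_perm ord0 (inord j.-1) 1%g).

Lemma lift_pair_perm0 N (i j : 'I_N.+2) : lift_pair_perm i j ord0 = i.
Proof. exact: lift_perm_id. Qed.

Lemma lift_pair_perm1 N (i j : 'I_N.+2) :
  (i < j)%N -> lift_pair_perm i j (lift ord0 ord0) = j.
Proof.
move=> ij; rewrite /lift_pair_perm lift_perm_lift lift_perm_id.
apply: val_inj; case: j ij => -[|j] //= jN ij.
by rewrite inordK ?bumpE // /bump -ltnS ij.
Qed.

Lemma lift_pair_perm_tail N (i j : 'I_N.+2) (t : 'I_N) :
  (i < j)%N ->
  lift_pair_perm i j (lift ord0 (lift ord0 t)) = bump j (bump i t) :> nat.
Proof.
move=> ij; rewrite /lift_pair_perm !lift_perm_lift perm1 /=.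
(* The nested lifts skip j - 1 first and then i, whereas the coboundary formula skips i first and
   then j; [bumpC] exchanges the two orders. *)
case: j ij => -[|j] //= jN ij; rewrite inordK // bumpC.
congr (bump _ (bump _ _)); first by rewrite /bump -ltnS ij.
by rewrite /unbump ltnNge -ltnS ij subn0.
Qed.

Lemma lift_pair_perm_shuffle N (i j : 'I_N.+2) :
  (i < j)%N -> shuffle 2 (lift_pair_perm i j).
Proof.
move=> ij; apply/shuffleP => a b; case: (unliftP ord0 a) => [a'|] ->.
  case: (unliftP ord0 b) => [b'|] -> //.
  case: (unliftP ord0 a') => [a''|] ->; case: (unliftP ord0 b') => [b''|] -> //.
  by rewrite !ltn_lift /lift_pair_perm !lift_perm_lift !perm1 !ltn_lift.
case: (unliftP ord0 b) => [b'|] -> //.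
case: (unliftP ord0 b') => [b''|] -> // _ _.
by rewrite lift_pair_perm0 lift_pair_perm1.
Qed.

Lemma big_shuffle2 (V : nmodType) N (F : 'S_N.+2 -> V) :
  \sum_(s : 'S_N.+2 | shuffle 2 s) F s =
  \sum_(i < N.+2) \sum_(j < N.+2 | (i < j)%N) F (lift_pair_perm i j).
Proof.
rewrite pair_big_dep /= (reindex_onto (fun u => lift_pair_perm u.1 u.2)
  (fun s : 'S_N.+2 => (s ord0, s (lift ord0 ord0)))) /= => [|s shs].
  apply: eq_bigl => -[i j] /=; apply/andP/idP => [[shs /eqP] | ij].
    rewrite lift_pair_perm0 => -[e]; rewrite -e.
    move/shuffleP: shs => /(_ ord0 (lift ord0 ord0)).
    by rewrite lift_pair_perm0; apply.
  by rewrite lift_pair_perm0 lift_pair_perm1 // lift_pair_perm_shuffle.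
have ss : (s ord0 < s (lift ord0 ord0))%N by move/shuffleP: shs; apply.
apply: (shuffle_eq (b := false) (lift_pair_perm_shuffle ss) shs) => i.
case: (unliftP ord0 i) => [i'|] ->; last by rewrite lift_pair_perm0.
by case: (unliftP ord0 i') => [i''|] ->; rewrite ?lift_pair_perm1.
Qed.

(** There are N - i inversions, a number of the same parity as N + i. *)
Lemma sign_lift_perm_max (R : pzRingType) N (i : 'I_N.+1) :
  (-1) ^+ lift_perm ord_max i 1%g = (-1) ^+ (N + i) :> R.
Proof.
by rewrite odd_lift_perm odd_perm1 addbF signr_addb !signr_odd exprD.
Qed.

(** There are i + (j - 1) inversions, hence the extra minus sign. *)
Lemma sign_lift_pair_perm (R : pzRingType) N (i j : 'I_N.+2) :
  (i < j)%N -> (-1) ^+ lift_pair_perm i j = - (-1) ^+ (i + j) :> R.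
Proof.
case: j => -[|j] //= jN ij; rewrite /lift_pair_perm !odd_lift_perm odd_perm1 /=.
rewrite inordK // addbF ?signr_addb ?expr0 ?mul1r ?signr_odd.
by rewrite addnS exprS mulN1r opprK exprD.
Qed.

End Shuffles.

(** * Compositions with a 2-cochain as sums over indices *)

Section Circ.
Context (K : fieldType) (V : lmodType {poly K}) (gamma : V -> V) (p : nat).

(** The shuffles are indexed by the one argument left outside [g]; the first slot of [f] gets the
    sum of the other parameters, computed by [sum_lam_lift]. *)
Lemma circ_bilinear (f : cmap 2 V V) (g : cmap p.+1 V V) e :
  circ gamma (N := p.+1) (m := 1) f g e =
  \sum_(i < p.+2) (-1) ^+ (p.+1 + i) *:
    lpoly_ext (fun k : 'I_p => lam K (lift i (widen_ord (leqnSn p) k)))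
      (fun u => at1 (- dvar K p.+1 - lam K i)
         (f [ffun k : 'I_2 => scons u (fun=> iter p gamma (e i)) k]))
      (g [ffun k => e (lift i k)]).
Proof.
rewrite /circ big_shuffle_max; apply: eq_bigr => i _.
rewrite sign_lift_perm_max.
have head (k : 'I_p.+1) : lift_perm ord_max i 1%g (inord k) = lift i k.
  rewrite (_ : inord k = lift ord_max k) ?lift_perm_lift ?perm1 //.
  apply: val_inj; rewrite [RHS]lift_max /= inordK //.
  exact: ltnW (ltn_ord k).
have tail : lift_perm ord_max i 1%g (inord (p.+1 + 0)) = i.
  rewrite (_ : inord _ = ord_max) ?lift_perm_id //.
  by apply: val_inj; rewrite /= addn0 inordK.
apply: (congr1 (fun F => _ *: F)); apply: eq_lpoly_ext => [k|u|].
- by rewrite -(head (widen_ord (leqnSn p) k)).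
- apply: eq_lpoly_subst => [k|].
    rewrite ord1 /=; apply: etrans (eq_bigr _ _) (sum_lam_lift K i).
    by move=> k' _; rewrite head.
  apply: congr1; apply/ffunP => k; rewrite !ffunE.
  by case: k => -[|[|k]] //= _; rewrite tail.
by apply: congr1; apply/ffunP => k; rewrite !ffunE head.
Qed.

(** The pair i < j is the one inserted into [g]. Each summand has the shape of the bracket part of
    [coboundary], with the opposite sign coming from [sign_lift_pair_perm]. *)
Lemma circ_bracket (f : cmap p.+1 V V) (g : cmap 2 V V) e :
  circ gamma (N := p.+1) (n := 1) f g e =
  \sum_(i < p.+2) \sum_(j < p.+2 | (i < j)%N) - (-1) ^+ (i + j) *:
    lpoly_ext (fun=> lam K i)
      (fun u =>
         let rest t : 'I_p.+2 := inord (bump j (bump i t)) in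
         lpoly_subst
           (fun k : 'I_p =>
              scons (lam K i + lam K j) (fun t => lam K (rest t)) k)
           (f [ffun k : 'I_p.+1 => scons u (fun t => gamma (e (rest t))) k]))
      (g [ffun k : 'I_2 => scons (e i) (fun=> e j) k]).
Proof.
rewrite /circ big_shuffle2; apply: eq_bigr => i _; apply: eq_bigr => j ij.
rewrite (sign_lift_pair_perm _ ij).
have head0 : lift_pair_perm i j (inord 0) = i.
  rewrite (_ : inord 0 = ord0) ?lift_pair_perm0 //.
  by apply: val_inj; rewrite /= inordK.
have head1 : lift_pair_perm i j (inord 1) = j.
  rewrite (_ : inord 1 = lift ord0 ord0) ?lift_pair_perm1 //.
  by apply: val_inj; rewrite /= inordK.
(* The bound on [t] keeps [inord (2 + t)] in range; beyond it [inord] would return a default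
   index. *)
have tail t : (t < p)%N ->
    lift_pair_perm i j (inord (2 + t)) = inord (bump j (bump i t)).
  move=> tp; rewrite -(lift_pair_perm_tail (Ordinal tp) ij) inord_val.
  congr (lift_pair_perm i j _); apply: val_inj.
  by rewrite /= inordK //= !ltnS.
apply: (congr1 (fun F => _ *: F)); apply: eq_lpoly_ext => [k|u|].
- by rewrite ord1 head0.
- apply: eq_lpoly_subst => [[[|t] tp] /=|].
  + by rewrite !big_ord_recl big_ord0 /= head0 head1 addr0.
  + by rewrite tail // ltnW.
  apply: congr1; apply/ffunP => -[[|t] tp]; rewrite !ffunE //=.
  by rewrite tail.
apply: congr1; apply/ffunP => -[[|[|t]] tp]; rewrite !ffunE //=.
- by rewrite head0.
- by rewrite head1.
Qed.

End Circ.

(** * The bracket of m_c + rho and T *)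

Section Additivity.
Context (K : fieldType).
Implicit Types V W : lmodType {poly K}.

Lemma sub_zmod_morphism (A B : zmodType) (f g : A -> B) :
  zmod_morphism f -> zmod_morphism g -> zmod_morphism (fun x => f x - g x).
Proof. by move=> fB gB x y; rewrite fB gB !opprD !opprK addrACA. Qed.

Lemma add_zmod_morphism (A B : zmodType) (f g : A -> B) :
  zmod_morphism f -> zmod_morphism g -> zmod_morphism (fun x => f x + g x).
Proof. by move=> fB gB x y; rewrite fB gB opprD addrACA. Qed.

Lemma opp_zmod_morphism (A B : zmodType) (f : A -> B) :
  zmod_morphism f -> zmod_morphism (fun x => - f x).
Proof. by move=> fB x y; rewrite fB opprD. Qed.

(** C-linearity at c = -1 already gives subtraction, once [cvar N (-1)] is identified with -1 in
    [pring]. *)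
Lemma C_linear_poly_zmod_morphism V N W (g : V -> lpoly N W) :
  C_linear_poly g -> zmod_morphism g.
Proof.
move=> gL x y.
have cN1 : cvar N (-1 : K) = -1.
  rewrite /cvar polyCN; apply: etrans (monalgUN _ _) _.
  exact: (congr1 -%R (mpolyC1E _ _)).
have := gL (-1) y x; rewrite cN1 scaleN1r polyCN scaleN1r => E.
by rewrite addrC E addrC.
Qed.

Lemma cochain_head_zmod_morphism V W (gamma : V -> V) (gamma' : W -> W) p
    (f : cmap p.+1 V W) (c : nat -> V) :
  cochain gamma gamma' f ->
  zmod_morphism (fun x => f [ffun k : 'I_p.+1 => scons x c k]).
Proof.
move=> fC; pose v : {ffun 'I_p.+1 -> V} := [ffun k : 'I_p.+1 => scons 0 c k].
have fE x : f [ffun k : 'I_p.+1 => scons x c k] = f (update v ord0 x).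
  by apply: congr1; apply/ffunP => -[[|k] kp]; rewrite !ffunE.
move=> x y; rewrite !fE.
exact: (C_linear_poly_zmod_morphism (cochain_linear fC v ord0)).
Qed.

End Additivity.

Section Bracket.
Context (K : fieldType) (L M : lmodType {poly K}).
Context (br : L -> L -> lpoly 1 L) (alpha : L -> L).
Context (rho : L -> M -> lpoly 1 M) (beta : M -> M) (T : {linear M -> L}).
Context (hL : hom_lie_conformal br alpha).
Context (hrho : hlc_representation br alpha rho beta).

Local Notation gamma := (twist_sum alpha beta).
Local Notation mu2 := (- dvar K 1 - lvar K ord0).

Lemma br_zmod_morphisml y : zmod_morphism (br^~ y).
Proof. exact: C_linear_poly_zmod_morphism (hlc_linear_l hL y). Qed.

Lemma br_zmod_morphismr x : zmod_morphism (br x).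
Proof. exact: C_linear_poly_zmod_morphism (hlc_linear_r hL x). Qed.

Lemma rho_zmod_morphisml m : zmod_morphism (rho^~ m).
Proof. exact: C_linear_poly_zmod_morphism (rep_linear hrho m). Qed.

Lemma rho_zmod_morphismr x : zmod_morphism (rho x).
Proof. exact: C_linear_poly_zmod_morphism (gc_linear (rep_gc hrho x)). Qed.

Lemma T_zmod_morphism : zmod_morphism T.
Proof. exact: raddfB. Qed.

Lemma T_scalable : scalable T.
Proof. by move=> c x; rewrite linearZ. Qed.

(** Closed form of nu. By skew-symmetry [- at1 mu2 (br (T b) x)] is [x_l T b]; it is left in this
    form because, together with the term in [rho x b], it is - rho_T(b) x with reversed
    parameter. *)
Definition semidirect_T (x : L) (a : M) (y : L) (b : M) :
    lpoly 1 (L * M)%type :=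
  lpoly_pair
    (br (T a) y - at1 mu2 (br (T b) x)
      - lpoly_map T (rho x b - at1 mu2 (rho y a)))
    (rho (T a) b - at1 mu2 (rho (T b) a)).

Lemma iter_twist_sum n (e : L * M) :
  iter n gamma e = (iter n alpha e.1, iter n beta e.2).
Proof. by elim: n => [|n IHn] /=; [case: e | rewrite IHn]. Qed.

Lemma lam_ord0 : lam K (ord0 : 'I_2) = lvar K ord0.
Proof. by rewrite -(lam_widen K ord0); apply: congr1; apply: val_inj. Qed.

Lemma pair_zmod_morphism (A : zmodType) N (f : A -> lpoly N L)
    (g : A -> lpoly N M) :
  zmod_morphism f -> zmod_morphism g ->
  zmod_morphism (fun x => lpoly_pair (f x) (g x)).
Proof. by move=> fB gB x y; rewrite fB gB lpoly_pairB. Qed.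

Lemma fst_zmod_morphism : zmod_morphism (fun u : L * M => u.1).
Proof. by []. Qed.

Lemma snd_zmod_morphism : zmod_morphism (fun u : L * M => u.2).
Proof. by []. Qed.

Lemma semidirect_scons (u v : L * M) :
  semidirect br rho [ffun k : 'I_2 => scons u (fun=> v) k] =
  lpoly_pair (br u.1 v.1) (rho u.1 v.2 - at1 mu2 (rho v.1 u.2)).
Proof. by rewrite /semidirect !ffunE. Qed.

Lemma semidirect_zmod_morphisml (v : L * M) : zmod_morphism
  (fun u => semidirect br rho [ffun k : 'I_2 => scons u (fun=> v) k]).
Proof.
have aB : zmod_morphism (fun u : L * M =>
    lpoly_pair (br u.1 v.1) (rho u.1 v.2 - at1 mu2 (rho v.1 u.2))).
  apply: pair_zmod_morphism.
    exact: comp_zmod_morphism (br_zmod_morphisml _) fst_zmod_morphism.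
  apply: sub_zmod_morphism.
    exact: comp_zmod_morphism (rho_zmod_morphisml _) fst_zmod_morphism.
  apply: comp_zmod_morphism; first exact: at1_zmod_morphism.
  exact: comp_zmod_morphism (rho_zmod_morphismr _) snd_zmod_morphism.
by move=> x y; rewrite !semidirect_scons; exact: aB.
Qed.

Lemma embed_cochain1 v :
  embed (cochain1 T) v = lconst 0 ((T (v ord0).2, 0) : L * M).
Proof.
rewrite /embed lpoly_pairl /cochain1 ffunE.
by rewrite lpoly_map_const //; exact: inl_zmod_morphism.
Qed.

(** The 1-cochain [T] is constant in the formal variables and has values in L, so the extension is
    evaluation at (T a, 0), where the second term of the M-component vanishes. *)
Lemma circ_semidirect_T_term (i : 'I_2) e (q : pring K 1) :
  lpoly_ext (fun k : 'I_0 => lam K (lift i (widen_ord (leqnSn 0) k)))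
    (fun u => at1 q (semidirect br rho
       [ffun k : 'I_2 => scons u (fun=> iter 0 gamma (e i)) k]))
    (embed (cochain1 T) [ffun k => e (lift i k)]) =
  lpoly_pair (at1 q (br (T (e (lift i ord0)).2) (e i).1))
    (at1 q (rho (T (e (lift i ord0)).2) (e i).2)).
Proof.
rewrite embed_cochain1 lpoly_ext_const; last first.
  apply: comp_zmod_morphism (semidirect_zmod_morphisml _).
  exact: at1_zmod_morphism.
rewrite semidirect_scons /= !ffunE (zmod_morphism0 (rho_zmod_morphismr _)).
rewrite (zmod_morphism0 (@at1_zmod_morphism K 1 M mu2)) subr0.
exact: subst_pair.
Qed.

Lemma circ_semidirect_T (e : {ffun 'I_2 -> (L * M)%type}) :
  circ gamma (N := 1) (m := 1) (semidirect br rho) (embed (cochain1 T)) e =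
  lpoly_pair (br (T (e ord0).2) (e ord_max).1)
    (rho (T (e ord0).2) (e ord_max).2) -
  lpoly_pair (at1 mu2 (br (T (e ord_max).2) (e ord0).1))
    (at1 mu2 (rho (T (e ord_max).2) (e ord0).2)).
Proof.
apply: etrans (circ_bilinear _ _ _ _) _.
have l0 : lift ord0 ord0 = ord_max :> 'I_2 by apply: val_inj.
have l1 : lift ord_max ord0 = ord0 :> 'I_2 by apply: val_inj.
rewrite big_ord_recl big_ord1 l0 !circ_semidirect_T_term.
rewrite l0 l1 lam_ord0 lam_max big_ord1.
(* For the identity shuffle the outer argument is the last one, whose parameter is - l - d, and its
   reversal is l. The transposition keeps [mu2]. *)
rewrite (_ : - dvar K 1 - (- lvar K ord0 - dvar K 1) = lvar K ord0); last first.
  by rewrite opprB opprK addrA addNr add0r.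
rewrite !at1_id addrC addn0 expr1 scaleN1r.
by rewrite (_ : (-1) ^+ _ = 1) ?scale1r //= /bump sqrrN expr1n.
Qed.

(** An embedded cochain reads only M-components, so the L-part [A] of an inserted value contributes
    [H 0], which is 0. *)
Lemma lpoly_ext_snd n N (theta : 'I_n -> pring K N) (H : M -> lpoly N L)
    (A : lpoly n L) (B : lpoly n M) :
  zmod_morphism H ->
  lpoly_ext theta (fun u : L * M => lpoly_pair (H u.2) (0 : lpoly N M))
    (lpoly_pair A B) =
  lpoly_pair (lpoly_ext theta H B) 0.
Proof.
move=> HB; have HsB : zmod_morphism (fun u : L * M => H u.2).
  exact: comp_zmod_morphism HB snd_zmod_morphism.
rewrite (lpoly_ext_pairl _ theta _ HsB).
apply: (congr1 (fun F => lpoly_pair F 0)).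
rewrite (lpoly_ext_pair theta _ _ HsB).
rewrite [X in X + _](_ : _ = 0) ?add0r //.
rewrite /lpoly_ext /mlift big1 // => k _.
by rewrite /= (zmod_morphism0 HB) scaler0.
Qed.

Lemma circ_T_semidirect (e : {ffun 'I_2 -> (L * M)%type}) :
  circ gamma (N := 1) (m := 0) (n := 1)
    (embed (cochain1 T)) (semidirect br rho) e =
  lpoly_pair (lpoly_map T (rho (e ord0).1 (e ord_max).2 -
    at1 mu2 (rho (e ord_max).1 (e ord0).2))) 0.
Proof.
apply: etrans (circ_bracket _ _ _ _) _.
(* The row i = 1 is empty and the row i = 0 contains only j = 1. *)
rewrite big_ord_recl big_ord1 [X in _ + X]big1 ?addr0; last first.
  by move=> -[[|[|j]] jN].
rewrite (big_pred1 (ord_max : 'I_2)); last by case=> -[|[|j]] jN.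
rewrite add0n expr1 opprK scale1r semidirect_scons lam_ord0.
have TcB : zmod_morphism (fun w : M => lconst 1 (T w)).
  exact: comp_zmod_morphism (@lconst_zmod_morphism K 1 L) T_zmod_morphism.
apply: etrans (_ : lpoly_ext (fun=> lvar K ord0)
  (fun u : L * M => lpoly_pair (lconst 1 (T u.2)) 0) _ = _).
  apply: eq_lpoly_ext => // u.
  rewrite /= embed_cochain1 subst_const ffunE lpoly_pairl lpoly_map_const //.
  exact: inl_zmod_morphism.
rewrite (lpoly_ext_snd _ _ _ TcB); apply: (congr1 (fun F => lpoly_pair F 0)).
apply: etrans (at1_id _); apply: esym.
exact: (lpoly_ext_map T_zmod_morphism _ _ (@lconst_zmod_morphism K 1 L)).
Qed.

End Bracket.

(** * The bracket nu and its relation to rho_T *)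

Section Main.
Context (K : fieldType) (L M : lmodType {poly K}).
Context (br : L -> L -> lpoly 1 L) (alpha : L -> L).
Context (rho : L -> M -> lpoly 1 M) (beta : M -> M) (T : {linear M -> L}).
Context (hL : hom_lie_conformal br alpha).
Context (hrho : hlc_representation br alpha rho beta).

Local Notation gamma := (twist_sum alpha beta).
Local Notation mu2 := (- dvar K 1 - lvar K ord0).

(* [m_c + rho, T] *)
Definition bracket_T : cmap 2 (L * M)%type (L * M)%type :=
  NR_bracket gamma (m := 1) (n := 0) (semidirect br rho) (embed (cochain1 T)).

Lemma bracket_TE (e : {ffun 'I_2 -> (L * M)%type}) :
  bracket_T e =
  semidirect_T br rho T (e ord0).1 (e ord0).2 (e ord_max).1 (e ord_max).2.
Proof.
(* The arities [(1 + 0).+1] and 2 are convertible, so [NR_bracket] unfolds to two compositions at N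
   = 1. *)
have -> : bracket_T e =
    circ gamma (N := 1) (m := 1) (semidirect br rho) (embed (cochain1 T)) e -
    (-1) ^+ (1 * 0)%N *: circ gamma (N := 1) (m := 0) (n := 1)
      (embed (cochain1 T)) (semidirect br rho) e by [].
rewrite (circ_semidirect_T T hL hrho) circ_T_semidirect scale1r.
by rewrite -!lpoly_pairB subr0.
Qed.

Lemma bracket_T_scons (u v : L * M) :
  bracket_T [ffun k : 'I_2 => scons u (fun=> v) k] =
  semidirect_T br rho T u.1 u.2 v.1 v.2.
Proof. by rewrite bracket_TE !ffunE. Qed.

Lemma semidirect_T_zmod_morphism y b :
  zmod_morphism (fun u : L * M => semidirect_T br rho T u.1 u.2 y b).
Proof.
have aB := @at1_zmod_morphism K 1.
have T2B : zmod_morphism (fun u : L * M => T u.2).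
  exact: comp_zmod_morphism (T_zmod_morphism T) (@snd_zmod_morphism _ _ _).
have brB x : zmod_morphism (fun u : L * M => br x u.1).
  exact: comp_zmod_morphism (br_zmod_morphismr hL _) (@fst_zmod_morphism _ _ _).
have rhoB x : zmod_morphism (fun u : L * M => rho x u.2).
  apply: comp_zmod_morphism (rho_zmod_morphismr hrho _) _.
  exact: snd_zmod_morphism.
rewrite /semidirect_T; apply: pair_zmod_morphism.
  apply: sub_zmod_morphism.
    apply: sub_zmod_morphism.
      exact: comp_zmod_morphism (br_zmod_morphisml hL y) T2B.
    exact: comp_zmod_morphism (aB _ _) (brB _).
  apply: comp_zmod_morphism.
    exact/lpoly_map_zmod_morphism/T_zmod_morphism.
  apply: sub_zmod_morphism.
    apply: comp_zmod_morphism (rho_zmod_morphisml hrho b) _.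
    exact: fst_zmod_morphism.
  exact: comp_zmod_morphism (aB _ _) (rhoB _).
apply: sub_zmod_morphism.
  exact: comp_zmod_morphism (rho_zmod_morphisml hrho b) T2B.
exact: comp_zmod_morphism (aB _ _) (rhoB _).
Qed.

(** Setting a = 0 kills the M-component and leaves - [T b_{-d-l} w] - T(rho(w)_l b). Substituting -
    d - q turns the first parameter back into q and gives the second the reversed form found in
    rho_T. *)
Lemma at1_semidirect_T N (q : pring K N) w y b :
  at1 (- dvar K N - q) (semidirect_T br rho T w 0 y b) =
  lpoly_pair (- at1 q (subadj_action br rho T b w)) 0.
Proof.
have T0 := zmod_morphism0 (T_zmod_morphism T).
have aB n q' W := @at1_zmod_morphism K n W q'.
have mB n := lpoly_map_zmod_morphism (T_zmod_morphism T) (N := n).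
have -> : semidirect_T br rho T w 0 y b =
    lpoly_pair (- at1 mu2 (br (T b) w) - lpoly_map T (rho w b)) 0.
  rewrite /semidirect_T T0 (zmod_morphism0 (br_zmod_morphisml hL y)).
  rewrite (zmod_morphism0 (rho_zmod_morphisml hrho b)).
  rewrite (zmod_morphism0 (rho_zmod_morphismr hrho y)).
  rewrite (zmod_morphism0 (rho_zmod_morphismr hrho (T b))).
  by rewrite (zmod_morphism0 (aB 1 mu2 M)) sub0r !subr0.
rewrite /at1 subst_pair -!/(at1 _ _) (zmod_morphism0 (aB _ _ _)).
apply: (congr1 (fun F => lpoly_pair F 0)).
rewrite /subadj_action (zmod_morphismD (aB N q L)) opprD.
rewrite (aB N (- dvar K N - q) L) (zmod_morphismN (aB N _ L)).
apply: (congr2 (fun F G => - F - G)).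
  by rewrite at1_at1 opprB addrCA subrr addr0.
apply: etrans (esym (lpoly_map_subst (T_zmod_morphism T) (T_scalable T) _ _)) _.
apply: etrans (lpoly_map_subst (T_zmod_morphism T) (T_scalable T) _ _).
by apply: congr1; apply/esym/at1_at1.
Qed.

Lemma subadj_action_zmod_morphism b :
  zmod_morphism (subadj_action br rho T b).
Proof.
have rB : zmod_morphism (fun w => lpoly_map T (at1 mu2 (rho w b))).
  apply: comp_zmod_morphism.
    exact/lpoly_map_zmod_morphism/T_zmod_morphism.
  apply: comp_zmod_morphism; first exact: at1_zmod_morphism.
  exact: rho_zmod_morphisml hrho b.
exact: add_zmod_morphism (br_zmod_morphismr hL (T b)) rB.
Qed.

(** * The coboundary as a double bracket *)

Section Cochain.
Context (p : nat) (P : cmap p.+1 M L) (e : {ffun 'I_p.+2 -> (L * M)%type}).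
Context (hP : cochain beta alpha P).

Let m : {ffun 'I_p.+2 -> M} := [ffun i => (e i).2].

(** Values of [embed P] have zero M-component, so [at1_semidirect_T] applies to every summand; the
    minus sign comes from there. *)
Lemma circ_bracket_T_embed :
  circ gamma (N := p.+1) (m := 1) bracket_T (embed P) e =
  \sum_(i < p.+2) - (-1) ^+ (p.+1 + i) *: lpoly_pair
    (lpoly_ext (fun k : 'I_p => lam K (lift i (widen_ord (leqnSn p) k)))
       (fun w => at1 (lam K i)
          (subadj_action br rho T (iter p beta (m i)) w))
       (P [ffun k : 'I_p.+1 => m (lift i k)])) 0.
Proof.
apply: etrans (circ_bilinear _ _ _ _) _; apply: eq_bigr => i _.
set theta := fun k => _; set q := lam K i.
rewrite scaleNr -scalerN; apply: (congr1 (fun F => _ *: F)).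
(* [y] disappears with [at1_semidirect_T], so that only the M-components of [e] remain. *)
pose y := iter p alpha (e i).1; pose b := iter p beta (e i).2.
have sB : zmod_morphism (fun u : L * M =>
    at1 (- dvar K p.+1 - q) (semidirect_T br rho T u.1 u.2 y b)).
  apply: comp_zmod_morphism (semidirect_T_zmod_morphism y b).
  exact: at1_zmod_morphism.
have rB : zmod_morphism (fun w => at1 q (subadj_action br rho T b w)).
  apply: comp_zmod_morphism (subadj_action_zmod_morphism b).
  exact: at1_zmod_morphism.
pose Pm := P [ffun k : 'I_p.+1 => m (lift i k)].
apply: etrans (_ : lpoly_ext theta _ (lpoly_map (fun v => (v, 0)) Pm) = _).
  apply: eq_lpoly_ext => [//|u|].
    by rewrite bracket_T_scons iter_twist_sum.
  apply: etrans (lpoly_pairl _ _); apply: (congr1 (fun F => lpoly_pair F 0)).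
  by apply: congr1; apply/ffunP => k; rewrite !ffunE.
apply: etrans (lpoly_ext_map (@inl_zmod_morphism _ _ _) _ _ sB) _.
apply: etrans (_ : lpoly_ext theta (fun w => lpoly_pair
  (- at1 q (subadj_action br rho T b w)) 0) Pm = _).
  by apply: eq_lpoly_ext => // w; exact: at1_semidirect_T.
have rN : zmod_morphism (fun w => - at1 q (subadj_action br rho T b w)).
  exact: opp_zmod_morphism.
apply: etrans (lpoly_ext_pairl _ _ _ rN) _.
apply: etrans (congr1 (fun F => lpoly_pair F 0) (lpoly_extN _ _ _)) _.
apply: etrans (zmod_morphismN (@lpoly_pairl_zmod_morphism _ _ _ _) _) _.
by rewrite [m i]ffunE.
Qed.

(** [P] reads only the M-component of the value inserted in its first slot, and for nu that
    component is the sub-adjacent bracket. *)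
Lemma circ_embed_bracket_T :
  circ gamma (N := p.+1) (n := 1) (embed P) bracket_T e =
  \sum_(i < p.+2) \sum_(j < p.+2 | (i < j)%N) - (-1) ^+ (i + j) *: lpoly_pair
    (lpoly_ext (fun=> lam K i)
      (fun u =>
         let rest t : 'I_p.+2 := inord (bump j (bump i t)) in
         lpoly_subst
           (fun k : 'I_p =>
              scons (lam K i + lam K j) (fun t => lam K (rest t)) k)
           (P [ffun k : 'I_p.+1 => scons u (fun t => beta (m (rest t))) k]))
      (subadj_bracket rho T (m i) (m j))) 0.
Proof.
apply: etrans (circ_bracket _ _ _ _) _; apply: eq_bigr => i _.
apply: eq_bigr => j ij; apply: (congr1 (fun F => _ *: F)).
rewrite bracket_T_scons /subadj_bracket.
set theta := fun k : 'I_p => _.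
pose c t := beta (m (inord (bump j (bump i t)))).
have HB : zmod_morphism (fun u : M => lpoly_subst theta
    (P [ffun k : 'I_p.+1 => scons u c k])).
  apply: comp_zmod_morphism (cochain_head_zmod_morphism c hP).
  exact: subst_zmod_morphism.
apply: etrans (_ : lpoly_ext (fun=> lam K i) (fun u : L * M => lpoly_pair
    (lpoly_subst theta (P [ffun k : 'I_p.+1 => scons u.2 c k])) 0)
  (semidirect_T br rho T (e i).1 (e i).2 (e j).1 (e j).2) = _).
  apply: eq_lpoly_ext => [//|u|//].
  apply: etrans (subst_pair _ _ _) _.
  rewrite (zmod_morphism0 (@subst_zmod_morphism _ _ _ _ _)).
  apply: (congr1 (fun F => lpoly_pair F 0)); apply: congr1; apply: congr1.
  by apply/ffunP => -[[|k] kp]; rewrite !ffunE //= /c !ffunE.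
apply: etrans (lpoly_ext_snd _ _ _ HB) _.
by rewrite !ffunE.
Qed.

Lemma embed_delta_beta_alpha :
  embed (delta_beta_alpha br rho beta T P) e =
  (-1) ^+ p.+1 *: derived_bracket br alpha rho beta (cochain1 T) P e.
Proof.
(* Arities are shifted by one, so [T] has q = 0 here and the sign of the derived bracket is
   [(-1) ^+ 1]. *)
have -> : derived_bracket br alpha rho beta (cochain1 T) P e =
    (-1) ^+ 1 *: (circ gamma (N := p.+1) (m := 1) bracket_T (embed P) e -
      (-1) ^+ (1 * p)%N *:
        circ gamma (N := p.+1) (n := 1) (embed P) bracket_T e) by [].
rewrite mul1n scale_sign_sub circ_bracket_T_embed circ_embed_bracket_T.
have pB := @lpoly_pairl_zmod_morphism K L M p.+1.
apply: etrans (zmod_morphismD pB _ _) _; apply: (congr2 +%R).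
  apply: etrans (zmod_morphism_sum pB _ _ _) _; rewrite scaler_sumr.
  apply: eq_bigr => i _; apply: etrans (lpoly_pairlZ _ _ _) _.
  rewrite scalerA; apply: (congr1 (fun c => c *: _)).
  (* The product of [(-1) ^+ p] and [- (-1) ^+ (p.+1 + i)] is [(-1) ^+ i]. *)
  by rewrite addSn exprS mulN1r opprK exprD mulrA -expr2 sqrr_sign mul1r.
apply: etrans (zmod_morphism_sum pB _ _ _) _; rewrite -sumrN.
apply: eq_bigr => i _; rewrite -sumrN.
apply: etrans (zmod_morphism_sum pB _ _ _) _.
apply: eq_bigr => j _; apply: etrans (lpoly_pairlZ _ _ _) _.
(* The minus sign in front of P o nu cancels that of the pair shuffles. *)
by rewrite scaleNr opprK.
Qed.

End Cochain.

End Main.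

(** The degree of [P] is [p.+1], whence the sign [(-1) ^+ p.+1]. The equalities are taken in C(E, E)
    through [embed], and the second one holds by definition of [delta_T]. *)
Theorem proposition4p12 (R : realType) (L M : lmodType {poly R[i]})
  (br : L -> L -> lpoly 1 L) (alpha : L -> L)
  (rho : L -> M -> lpoly 1 M) (beta : M -> M) (T : {linear M -> L})
  (hL : hom_lie_conformal br alpha) (hmul : hlc_multiplicative br alpha)
  (hrho : hlc_representation br alpha rho beta)
  (hT : O_operator br alpha rho beta T)
  (p : nat) (P : cmap p.+1 M L) (hP : cochain beta alpha P) :
  forall e : {ffun 'I_p.+2 -> (L * M)%type},
    embed (delta_beta_alpha br rho beta T P) e =
      (-1) ^+ p.+1 *: derived_bracket br alpha rho beta (cochain1 T) P e /\
    (-1) ^+ p.+1 *: derived_bracket br alpha rho beta (cochain1 T) P e =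
      (-1) ^+ p.+1 *: delta_T br alpha rho beta T P e.
Proof.
by move=> e; split; first exact: embed_delta_beta_alpha.
Qed.
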